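(* For every $n\ge 1$ there is a bijection $\psi$ between the set $\mathcal{DU}_{2n-1}(4123)$ and the set of skew Yamanouchi words on the alphabet $\{1,2,3\}$ of type $(n-1,n,n+1)$ such that, for every $\pi=\pi_1\pi_2\ldots\pi_{2n-1}\in\mathcal{DU}_{2n-1}(4123)$, one has $\pi_1=\alpha(\psi(\pi))$ and $\mathcal{A}(\pi)=\mathcal{B}(\psi(\pi))$.
   Context: A permutation $\pi=\pi_1\cdots\pi_m$ of $[m]=\{1,\ldots,m\}$ is down-up alternating if $\pi_1>\pi_2<\pi_3>\pi_4<\cdots$; it avoids the pattern $4123$ if no subsequence $\pi_{i_1}\pi_{i_2}\pi_{i_3}\pi_{i_4}$ ($i_1<i_2<i_3<i_4$) satisfies $\pi_{i_2}<\pi_{i_3}<\pi_{i_4}<\pi_{i_1}$. $\mathcal{DU}_m(4123)$ is the set of $4123$-avoiding down-up alternating permutations of $[m]$. A word $w$ on $\{1,2,3\}$ has type $(c_1,c_2,c_3)$ if $c_i$ letters equal $i$. A word $w=w_1\cdots w_{3n}$ of type $(n-1,n,n+1)$ is a skew Yamanouchi word if, writing $a_1<\cdots<a_{n-1}$, $b_1<\cdots<b_n$, $c_1<\cdots<c_{n+1}$ for the positions of the letters $1$, $2$, $3$ respectively, one has $b_n<c_n$ and $a_j<b_j<c_j$ for all $1\le j\le n-1$. For a word $w$ containing a $3$, $\alpha(w)=j$ where $w_{j+1}$ is the leftmost letter of $w$ equal to $3$ (the length of the initial run). Define $\mathcal{A}(\pi)=\{0\}\cup\{k : \exists\, i<j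 \text{ with } \pi_i=k,\ \pi_j=k+1,\ k\le\pi_1-2\}$ for a permutation $\pi$, and $\mathcal{B}(w)=\{0\}\cup\{k : w_kw_{k+1}=12 \text{ and } k\le\alpha(w)-2\}$ for a word $w$. *)

(* Defs.v *)
From mathcomp Require Import all_boot all_fingroup.

Set Implicit Arguments.
Unset Strict Implicit.
Unset Printing Implicit Defensive.

(* A permutation of [m] = {1, ..., m} is an element of 'S_m; both positions and
   values of 'S_m start at 0, so that the one-line entry pi_(i+1) is (pi i).+1. *)

(* Positions are counted from 0: the descents are at the even i. *)
Definition down_up m (pi : 'S_m) : bool :=
  [forall i : 'I_m, forall j : 'I_m, (j == i.+1 :> nat) ==>
     (if odd i then pi i < pi j else pi j < pi i)].

Definition contains4123 m (pi : 'S_m) : bool :=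
  [exists i1 : 'I_m, exists i2 : 'I_m, exists i3 : 'I_m, exists i4 : 'I_m,
     [&& i1 < i2, i2 < i3, i3 < i4,
         pi i2 < pi i3, pi i3 < pi i4 & pi i4 < pi i1]].

Definition DU4123 m : {set 'S_m} :=
  [set pi : 'S_m | down_up pi && ~~ contains4123 pi].

Definition one_line m (pi : 'S_m) : seq nat := [seq (pi i).+1 | i : 'I_m].

(* The first entry pi_1; the default value 0 is only taken for m = 0. *)
Definition first_entry m (pi : 'S_m) : nat := head 0 (one_line pi).

(* k <= pi_1 - 2 is written without truncated subtraction. *)
Definition setA m (pi : 'S_m) : {pred nat} :=
  [pred k : nat | (k == 0) ||
     [exists i : 'I_m, exists j : 'I_m,
        [&& i < j, (pi i).+1 == k, (pi j).+1 == k.+1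
          & k + 2 <= first_entry pi]]].

Definition has_type (c1 c2 c3 : nat) (w : seq nat) : bool :=
  [&& all (fun x => x \in [:: 1; 2; 3]) w,
      count_mem 1 w == c1, count_mem 2 w == c2 & count_mem 3 w == c3].

(* The increasing list of the positions (from 0) of the letter x in w. *)
Definition positions (x : nat) (w : seq nat) : seq nat :=
  [seq i <- iota 0 (size w) | nth 0 w i == x].

(* a_j, b_j, c_j are the entries of index j.-1 of the lists a, b, c; all the
   indices used are in range when n >= 1 and w has type (n-1, n, n+1). *)
Definition skew_yamanouchi (n : nat) (w : seq nat) : bool :=
  let a := positions 1 w in
  let b := positions 2 w in
  let c := positions 3 w in
  [&& has_type (n - 1) n (n + 1) w,
      nth 0 b n.-1 < nth 0 c n.-1
    & [forall j : 'I_(n - 1),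
         (nth 0 a j < nth 0 b j) && (nth 0 b j < nth 0 c j)]].

(* index counts from 0, so it is the number of letters before the leftmost 3. *)
Definition alpha (w : seq nat) : nat := index 3 w.

(* w_k and w_(k+1), counted from 1, are nth 0 w k.-1 and nth 0 w k. *)
Definition setB (w : seq nat) : {pred nat} :=
  [pred k : nat | (k == 0) ||
     [&& 1 <= k, nth 0 w k.-1 == 1, nth 0 w k == 2 & k + 2 <= alpha w]].

(* Main.v *)
Require Import Defs.
From mathcomp Require Import all_boot all_fingroup zify.

Set Implicit Arguments.
Unset Strict Implicit.
Unset Printing Implicit Defensive.

(** Both families are generated by the same succession rule on the labels
    (pi_1, A(pi)), resp. (alpha(w), B(w)).  A node labelled (p, A) has one child
    for each pair (u, v) with v <= u <= p, v < p and no k in A with v < k < u,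
    and this child is labelled (u + 2, {0} U {k in A | k < v} U {v+1 if v < u}).
    - A permutation of size 2n+1 is obtained from one of size 2n-1 by prepending
      two entries u+2 and v+1 (and shifting the others); avoiding 4123 means
      that the values between them are decreasing in position order and that
      u <= p, while alternation means v < p.
    - A word x y z with |x| = v, |x y| = u and no 3 in x y is sent to
      x 1 2 y 3 z.  Conversely one deletes the first 3 and the last factor 12 of
      the initial run, or, when that run is followed by 33, the last factor 12
      not using the last letter of the run. *)

(** * Succession rule *)

Definition admissible (p : nat) (A : pred nat) (u v : nat) : Prop :=
  [/\ v <= u, u <= p, v < p & forall k, v < k < u -> ~~ A k].

Definition child_set (A : pred nat) (u v : nat) : pred nat :=
  fun k => [|| k == 0, (k < v) && A k | (v < u) && (k == v.+1)].

(** [level_surj] and [ins_inj] give each node of positive level a unique parent and pair [(u, v)];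
    [lab_ins] and [labset_ins] make the label of a child depend only on [(u, v)] and the label of
    its parent. Any two such trees are therefore isomorphic. *)
Record succession_tree := SuccessionTree {
  node : Type;
  level : nat -> node -> Prop;
  lab : node -> nat;
  labset : node -> pred nat;
  root : node;
  ins : node -> nat -> nat -> node;
  level0P : forall t, level 0 t <-> t = root;
  lab_root : lab root = 1;
  labset_root : forall k, labset root k = (k == 0);
  level_ins : forall n t u v,
    level n t -> admissible (lab t) (labset t) u v -> level n.+1 (ins t u v);
  level_surj : forall n s, level n.+1 s ->
    exists t u v, [/\ level n t, admissible (lab t) (labset t) u v
                    & s = ins t u v];
  ins_inj : forall n t u v t' u' v',
    level n t -> admissible (lab t) (labset t) u v ->
    level n t' -> admissible (lab t') (labset t') u' v' ->
    ins t u v = ins t' u' v' -> [/\ t = t', u = u' & v = v'];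
  lab_ins : forall n t u v,
    level n t -> admissible (lab t) (labset t) u v -> lab (ins t u v) = u + 2;
  labset_ins : forall n t u v,
    level n t -> admissible (lab t) (labset t) u v ->
    forall k, labset (ins t u v) k = child_set (labset t) u v k
}.

(** Two nodes are matched when the same sequence of pairs [(u, v)] leads to them from the two roots.
    Admissibility is asked in [G] only, since matched nodes carry equal labels. *)
Inductive matched (G H : succession_tree) :
  nat -> node G -> node H -> Prop :=
| matched_root : matched 0 (root G) (root H)
| matched_ins n t t' u v of matched n t t'
    & admissible (lab t) (labset t) u v :
    matched n.+1 (ins t u v) (ins t' u v).

Lemma eq_admissible p A B u v :
  A =1 B -> admissible p A u v -> admissible p B u v.
Proof. by move=> eqAB [? ? ? h]; split=> // k /h; rewrite eqAB. Qed.

Lemma matched_sound G H n (s : node G) (w : node H) :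
  matched n s w ->
  [/\ level n s, level n w, lab s = lab w & labset s =1 labset w].
Proof.
elim=> [|{}n t t' u v _ [lt lt' eqp eqA] adm].
  split; [exact/level0P | exact/level0P | by rewrite !lab_root |].
  by move=> k; rewrite !labset_root.
have adm' : admissible (lab t') (labset t') u v.
  by rewrite -eqp; apply: eq_admissible adm.
split; [exact: level_ins | exact: level_ins | |].
  by rewrite (lab_ins lt adm) (lab_ins lt' adm').
move=> k; rewrite (labset_ins lt adm) (labset_ins lt' adm').
by rewrite /child_set eqA.
Qed.

Lemma matched_sym G H n (s : node G) (w : node H) :
  matched n s w -> matched n w s.
Proof.
elim=> [|{}n t t' u v m mS adm]; first exact: matched_root.
have [_ _ eqp eqA] := matched_sound m.
by apply: matched_ins => //; rewrite -eqp; apply: eq_admissible adm.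
Qed.

Lemma matched_total G H n (s : node G) :
  level n s -> exists w : node H, matched n s w.
Proof.
elim: n s => [|n IHn] s.
  by move/level0P=> ->; exists (root H); apply: matched_root.
case/level_surj=> t [u [v [lt adm ->]]].
by have [w m] := IHn _ lt; exists (ins w u v); apply: matched_ins.
Qed.

(** By [ins_inj] the path from the root to [s] is unique, and it determines the node of [H]. Through
    [matched_sym] this also gives injectivity. *)
Lemma matched_fun G H n (s : node G) (w w' : node H) :
  matched n s w -> matched n s w' -> w = w'.
Proof.
move=> m; elim: m w' => [|{}n t t' u v m IHm adm] w' m'.
  by have [_ /level0P-> _ _] := matched_sound m'.
(* The indices of [m'] become variables with equations, so that case analysis can invert it. *)
move en: n.+1 m' => N; move es: (ins t u v) => S m'.
case: m' en es => // n1 t1 t1' u1 v1 m1 adm1 [en] es; subst n1.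
have [lt _ _ _] := matched_sound m; have [lt1 _ _ _] := matched_sound m1.
have [? ? ?] := ins_inj lt adm lt1 adm1 es; subst.
by rewrite (IHm _ m1).
Qed.

(** * Permutations *)

Definition alternating (s : seq nat) : Prop :=
  forall i, i.+1 < size s ->
    if odd i then nth 0 s i < nth 0 s i.+1 else nth 0 s i.+1 < nth 0 s i.

(** The variables are values, located by [index]. An absent value has index [size s], so [d \in s]
    places all four in [s]. *)
Definition avoids4123 (s : seq nat) : Prop :=
  forall a b c d, index a s < index b s -> index b s < index c s ->
    index c s < index d s -> d \in s -> b < c -> c < d -> ~~ (d < a).

Definition du4123 (m : nat) (s : seq nat) : Prop :=
  [/\ uniq s, size s = m, forall x, x \in s -> 0 < x <= m,
      alternating s & avoids4123 s].

Definition ascents (s : seq nat) : pred nat :=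
  fun k => (k == 0) ||
    [&& k.+1 \in s, index k s < index k.+1 s & k + 2 <= head 0 s].

(** For [v <= u], the increasing relabelling that frees exactly the values [v.+1] and [u + 2]. *)
Definition bump2 (u v x : nat) : nat := x + (v < x) + (u < x).
Definition unbump2 (u v x : nat) : nat := x - (v.+1 < x) - (u + 2 < x).

Definition perm_ins (t : seq nat) (u v : nat) : seq nat :=
  u + 2 :: v.+1 :: map (bump2 u v) t.

Lemma bump2_mono u v x y : (bump2 u v x < bump2 u v y) = (x < y).
Proof. by rewrite /bump2; lia. Qed.

Lemma bump2_inj u v : injective (bump2 u v).
Proof. by move=> x y; rewrite /bump2; lia. Qed.

Lemma unbump2K u v x : v <= u -> x != u + 2 -> x != v.+1 ->
  bump2 u v (unbump2 u v x) = x.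
Proof. by move=> le_vu; rewrite /bump2 /unbump2; lia. Qed.

Lemma bump2_neq u v x : v <= u -> (bump2 u v x != u + 2) && (bump2 u v x != v.+1).
Proof. by move=> le_vu; rewrite /bump2; lia. Qed.

Lemma mem_range m s x :
  uniq s -> size s = m -> (forall y, y \in s -> 0 < y <= m) ->
  0 < x <= m -> x \in s.
Proof.
move=> Us sz rg hx.
have sub : {subset s <= iota 1 m} by move=> y /rg; rewrite mem_iota; lia.
have [_ ->] := uniq_min_size Us sub (eq_leq (etrans (size_iota 1 m) (esym sz))).
by rewrite mem_iota; lia.
Qed.

Lemma index_perm_ins t u v x : v <= u ->
  index (bump2 u v x) (perm_ins t u v) = (index x t).+2.
Proof.
move=> le_vu; have /andP[/negPf h1 /negPf h2] := bump2_neq x le_vu.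
by rewrite /perm_ins /= eq_sym h1 eq_sym h2 index_map //; apply: bump2_inj.
Qed.

Lemma mem_perm_ins t u v x : v <= u ->
  (bump2 u v x \in perm_ins t u v) = (x \in t).
Proof.
move=> le_vu; have /andP[/negPf h1 /negPf h2] := bump2_neq x le_vu.
by rewrite /perm_ins !inE h1 h2 mem_map //; apply: bump2_inj.
Qed.

Lemma perm_insP t u v x : v <= u -> x \in perm_ins t u v ->
  [\/ x = u + 2, x = v.+1 | exists2 y, y \in t & x = bump2 u v y].
Proof.
move=> le_vu; rewrite !inE => /or3P[/eqP->|/eqP->|/mapP[y yt ->]].
- by constructor 1.
- by constructor 2.
- by constructor 3; exists y.
Qed.

Lemma index0_head (s : seq nat) x : x \in s -> index x s = 0 -> x = head 0 s.
Proof. by case: s => // a s _ /=; case: eqP. Qed.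

Lemma index_head (s : seq nat) : index (head 0 s) s = 0.
Proof. by case: s => //= a s; rewrite eqxx. Qed.

Lemma alternating_ins t u v : 0 < size t -> v <= u ->
  alternating (perm_ins t u v) <-> alternating t /\ v < head 0 t.
Proof.
move=> t0 le_vu; split=> [alt|[alt lt_v]].
  split=> [i hi|].
    have := alt i.+2; rewrite /perm_ins /= size_map !ltnS negbK => /(_ hi).
    by rewrite !(nth_map 0) ?bump2_mono //; lia.
  have := alt 1; rewrite /perm_ins /= size_map !ltnS => /(_ t0).
  by rewrite (nth_map 0) // nth0 /bump2; lia.
case=> [|[|i]] /=; rewrite ?size_map ?ltnS => hi.
- by lia.
- by rewrite (nth_map 0) // nth0 /bump2; lia.
- have := alt i hi; rewrite negbK !(nth_map 0) ?bump2_mono //; lia.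
Qed.

(** Otherwise the positions would decrease all the way from [x] to [y]. This reduces a condition on
    all pairs of values to one on consecutive values, which is what the label set records. *)
Lemma ascent_between (s : seq nat) x y :
  (forall z, x <= z <= y -> z \in s) -> x < y -> index x s < index y s ->
  exists2 k, x <= k < y & index k s < index k.+1 s.
Proof.
elim: y => // y IHy mems; rewrite ltnS leq_eqVlt => /orP[/eqP<-|lt_xy] ixy.
  by exists x; rewrite ?leqnn.
case: (ltngtP (index y s) (index y.+1 s)) => iy.
- by exists y; rewrite // (ltnW lt_xy) /=.
- have [k hk ik] : exists2 k, x <= k < y & index k s < index k.+1 s.
    by apply: IHy => [z hz||]; [apply: mems|..]; lia.
  by exists k => //; lia.
- have := nth_index 0 (mems y _); rewrite iy nth_index ?mems //; lia.
Qed.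

(** The new entries fill the first two places, so [c] and [d] are old in any occurrence of 4123. If
    [b] is old, [t] contains an occurrence too; if [b] is new, [t] has an ascent forbidden by
    admissibility. *)
Lemma avoids_ins m t u v : du4123 m t -> admissible (head 0 t) (ascents t) u v ->
  avoids4123 (perm_ins t u v).
Proof.
move=> [Ut sz rg alt av] [le_vu le_up lt_vp noA].
(* As [d <= u <= head 0 t], the first entry of [t] would serve as the 4 for [b], [c], [d]. *)
have noB b c d : b \in t -> index b t < index c t -> index c t < index d t ->
    d \in t -> b < c -> c < d -> ~~ (d <= u).
  move=> bt ibc icd dt bc cd; apply/negP => du.
  have dp : d != head 0 t.
    by apply/eqP => e; move: icd; rewrite e index_head.
  have bp : 0 < index b t.
    by rewrite lt0n; apply/eqP => /(index0_head bt) e; lia.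
  have := av (head 0 t) b c d; rewrite index_head => /(_ bp ibc icd dt bc cd).
  by lia.
move=> a b c d iab ibc icd dI bc cd; apply/negP => da.
have mem x y : index x (perm_ins t u v) < index y (perm_ins t u v) ->
    y \in perm_ins t u v -> x \in perm_ins t u v.
  by rewrite -!index_mem; lia.
have cI := mem _ _ icd dI; have bI := mem _ _ ibc cI; have aI := mem _ _ iab bI.
have idx1 : index v.+1 (perm_ins t u v) = 1.
  by rewrite /= eqxx; case: eqP => //; lia.
have idx0 : index (u + 2) (perm_ins t u v) = 0 by rewrite /= eqxx.
have [e|e|[d' dt ed]] := perm_insP le_vu dI; try by subst d; lia.
have [e|e|[c' ct ec]] := perm_insP le_vu cI; try by subst c; lia.
subst c d; rewrite !index_perm_ins // !ltnS in icd; rewrite bump2_mono in cd.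
have [e|e|[b' bt eb]] := perm_insP le_vu bI; first by subst b; lia.
  subst b.
  have ea : a = u + 2.
    have [//|e|[a' at_ ea]] := perm_insP le_vu aI; first by subst a; lia.
    by subst a; rewrite index_perm_ins // in iab; lia.
  subst a.
  (* Here [v < c' < d' <= u], so the ascent found satisfies [v < k < u]. *)
  have [k hk ik] : exists2 k, c' <= k < d' & index k t < index k.+1 t.
    apply: ascent_between => // z hz; apply: (mem_range Ut sz rg).
    by move: (rg _ ct) (rg _ dt); lia.
  have kt : k.+1 \in t.
    by apply: (mem_range Ut sz rg); move: (rg _ ct) (rg _ dt); lia.
  (* With [k.+1 <= u <= head 0 t], this yields the bound [k + 2 <= head 0 t] required by
     [ascents]. *)
  have kp : k.+1 != head 0 t.
    by apply/eqP => e; move: ik; rewrite e index_head.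
  have := noA k; rewrite /ascents kt ik /= negb_or.
  by move: bc da hk; rewrite /bump2; lia.
subst b; rewrite !index_perm_ins // !ltnS in ibc; rewrite bump2_mono in bc.
have [e|e|[a' at_ ea]] := perm_insP le_vu aI; subst a.
- by have := noB _ _ _ bt ibc icd dt bc cd; move: da; rewrite /bump2; lia.
- by have := noB _ _ _ bt ibc icd dt bc cd; move: da; rewrite /bump2; lia.
- rewrite !index_perm_ins // !ltnS in iab; rewrite bump2_mono in da.
  by have := av _ _ _ _ iab ibc icd dt bc cd; rewrite da.
Qed.

Lemma du4123_ins m t u v : du4123 m t ->
  admissible (head 0 t) (ascents t) u v -> du4123 m.+2 (perm_ins t u v).
Proof.
move=> dut adm; have av := avoids_ins dut adm.
case: dut adm => [Ut sz rg alt _] [le_vu le_up lt_vp noA].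
have t0 : 0 < size t by case: (t) lt_vp => // /=; rewrite ltn0.
have pm : head 0 t <= m.
  by have := rg (head 0 t); rewrite -nth0 mem_nth // => /(_ isT); lia.
split=> //.
- rewrite /perm_ins /= map_inj_uniq ?Ut ?andbT; last exact: bump2_inj.
  rewrite inE negb_or -andbA; apply/and3P; split; first by lia.
    by apply/mapP => -[x _ e]; have := bump2_neq x le_vu; rewrite -e eqxx.
  by apply/mapP => -[x _ e]; have := bump2_neq x le_vu; rewrite -e eqxx andbF.
- by rewrite /= size_map sz.
- move=> x /(perm_insP le_vu) [->|->|[y yt ->]]; try by lia.
  by move: (rg _ yt); rewrite /bump2; lia.
- by apply/alternating_ins.
Qed.

Lemma du4123_surj m s : 0 < m -> du4123 m.+2 s ->
  exists t u v, [/\ du4123 m t, admissible (head 0 t) (ascents t) u v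
                  & s = perm_ins t u v].
Proof.
move=> m0 dus.
have [t [u [v [le_vu es]]]] : exists t u v, v <= u /\ s = perm_ins t u v.
  case: s dus => [|a [|b r]] [] //= Us sz rg alt _.
  have ba : b < a by have := alt 0; apply.
  have b0 : 0 < b by have := rg b; rewrite !inE eqxx orbT => /(_ isT); lia.
  (* The equations [a = u + 2] and [b = v.+1] are solved for [u] and [v]; nothing is truncated
     because [0 < b < a]. *)
  exists (map (unbump2 (a - 2) b.-1) r), (a - 2), b.-1; split; first by lia.
  rewrite /perm_ins; congr (_ :: _ :: _); [by lia | by lia |].
  rewrite -map_comp -[LHS]map_id; apply/eq_in_map => x xr /=.
  rewrite unbump2K //; first by lia.
    apply: contraTneq xr => ->; rewrite subnK //; last by lia.
    by case/andP: Us; rewrite inE negb_or => /andP[].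
  by apply: contraTneq xr => ->; rewrite prednK //; case/and3P: Us.
subst s; exists t, u, v; case: dus => Us sz rg alt av.
have sz' : size t = m by move: sz; rewrite /= size_map; lia.
have t0 : 0 < size t by rewrite sz'.
have [altt lt_vp] := (alternating_ins t0 le_vu).1 alt.
have Ut : uniq t by case/and3P: Us => _ _ /map_uniq.
have rgt x : x \in t -> 0 < x <= m.
  move=> xt; have := rg (u + 2); rewrite inE eqxx => /(_ isT).
  have := rg (bump2 u v x); rewrite mem_perm_ins // => /(_ xt).
  by rewrite /bump2; lia.
have um : u <= m by have := rg (u + 2); rewrite inE eqxx => /(_ isT); lia.
(* Together with [u + 2] and [v.+1], an increasing pair of values [c], [d] with [v < c] and [d <= u]
   would form a 4123. *)
have noasc c d : c < d -> v < c -> d <= u -> d \in t -> ~~ (index c t < index d t).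
  move=> cd vc du dt; apply/negP => icd.
  have := av (u + 2) v.+1 (bump2 u v c) (bump2 u v d).
  rewrite !index_perm_ins // mem_perm_ins // bump2_mono /= !eqxx.
  case: eqP => [|_]; first by lia.
  by move/(_ isT isT icd dt); rewrite /bump2; lia.
split=> //.
  split=> // a b c d iab ibc icd dt bc cd.
  have := av (bump2 u v a) (bump2 u v b) (bump2 u v c) (bump2 u v d).
  by rewrite !index_perm_ins // mem_perm_ins // !bump2_mono; apply.
split=> //.
(* If the first entry of [t] were below [u], it would form such a pair with [u]. *)
- rewrite leqNgt; apply/negP => lt_pu.
  have ut : u \in t by apply: (mem_range Ut sz' rgt); lia.
  have := noasc _ _ lt_pu lt_vp (leqnn _) ut; rewrite index_head -eqn0Ngt => /eqP.
  by move/(index0_head ut); lia.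
- move=> k hk; rewrite /ascents negb_or; apply/andP; split; first by lia.
  by apply/negP => /and3P[kt ik _]; have := noasc k k.+1; rewrite ik kt; lia.
Qed.

Lemma perm_ins_inj t u v t' u' v' : v <= u ->
  perm_ins t u v = perm_ins t' u' v' -> [/\ t = t', u = u' & v = v'].
Proof.
move=> le_vu; rewrite /perm_ins => -[eu ev em].
have {eu}eu : u = u' by lia.
by subst; split=> //; apply: inj_map em; apply: bump2_inj.
Qed.

(** For [k < v] nothing moves. For [k = v], only [u + 2] precedes [v.+1]. For [k = v.+1], the value
    [v.+2] is old, hence later, when [v < u]. A larger [k <= u] would come from [k.-1] in the label
    set of [t], which admissibility forbids. *)
Lemma ascents_ins m t u v : du4123 m t ->
  admissible (head 0 t) (ascents t) u v ->
  forall k, ascents (perm_ins t u v) k = child_set (ascents t) u v k.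
Proof.
move=> [Ut sz rg alt av] [le_vu le_up lt_vp noA] k.
have t0 : 0 < size t by case: (t) lt_vp => // /=; rewrite ltn0.
have pm : head 0 t <= m.
  by have := rg (head 0 t); rewrite -nth0 mem_nth // => /(_ isT); lia.
have idx1 : index v.+1 (perm_ins t u v) = 1.
  by rewrite /= eqxx; case: eqP => //; lia.
have memt x : 0 < x <= m -> x \in t by apply: mem_range.
have memE x y : bump2 u v x = y -> (y \in perm_ins t u v) = (x \in t).
  by move=> <-; rewrite mem_perm_ins.
have idxE x y : bump2 u v x = y -> index y (perm_ins t u v) = (index x t).+2.
  by move=> <-; rewrite index_perm_ins.
rewrite /ascents /child_set; case: (posnP k) => [->//|k0].
rewrite !orFb [head 0 (perm_ins _ _ _)]/(u + 2) leq_add2r.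
case: (ltngtP k v) => [kv|vk|ekv]; rewrite ?andTb ?andFb ?orFb.
- have e1 : bump2 u v k = k by rewrite /bump2; lia.
  have e2 : bump2 u v k.+1 = k.+1 by rewrite /bump2; lia.
  rewrite (memE _ _ e2) (idxE _ _ e1) (idxE _ _ e2) !ltnS.
  have -> : (k <= u) by lia.
  have -> : k + 2 <= head 0 t by lia.
  have -> : (k == v.+1) = false by lia.
  by rewrite andbF orbF.
- case: (ltngtP k v.+1) => [|vk'|ekv]; first by lia.
    rewrite andbF; apply/negP => /and3P[].
    have [ku|//] := leqP k u.
    have e1 : bump2 u v k.-1 = k by rewrite /bump2; lia.
    have e2 : bump2 u v k = k.+1 by rewrite /bump2; lia.
    rewrite (memE _ _ e2) (idxE _ _ e1) (idxE _ _ e2) !ltnS => kt ik _.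
    have kp : k != head 0 t by apply/eqP => e; move: ik; rewrite e index_head.
    by have := noA k.-1; rewrite /ascents prednK // kt ik /=; lia.
  rewrite andbT ekv idx1.
  case: (ltnP v u) => [vu|]; last by lia.
  have e : bump2 u v v.+1 = v.+2 by rewrite /bump2; lia.
  by rewrite (memE _ _ e) (idxE _ _ e) memt //; lia.
- subst k; rewrite idx1 ltnS leqn0.
  have -> : (v == v.+1) = false by lia.
  rewrite andbF; apply/negP => /and3P[_ /eqP + _] => /=.
  by case: eqP; lia.
Qed.

Lemma du4123_root s : du4123 1 s <-> s = [:: 1].
Proof.
split=> [[_ + rg _ _]|->].
  case: s rg => [|a [|]] // rg _; congr [:: _].
  by have := rg a; rewrite inE eqxx => /(_ isT); lia.
split=> //; first by move=> x; rewrite inE => /eqP->.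
move=> a b c d _ _ + /[!inE] /eqP dE.
by rewrite dE.
Qed.

Lemma ascents_root k : ascents [:: 1] k = (k == 0).
Proof.
by rewrite /ascents; case: k => //= k; rewrite inE.
Qed.

Definition perm_tree : succession_tree.
Proof.
refine (@SuccessionTree (seq nat) (fun n => du4123 n.*2.+1) (head 0) ascents
  [:: 1] perm_ins du4123_root erefl ascents_root _ _ _ _ _).
- by move=> n t u v; rewrite doubleS; apply: du4123_ins.
- by move=> n s; rewrite doubleS; apply: du4123_surj.
- by move=> n t u v t' u' v' _ [le_vu _ _ _] _ _; apply: perm_ins_inj.
- by [].
- by move=> n t u v; apply: ascents_ins.
Defined.

(** * Skew Yamanouchi words *)

(* For a prefix with a, b, c letters 1, 2, 3: a_j < b_j for j <= n and b_j < c_j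
   for j <= n+1, whence the truncations of b at n and of c at n+1. *)
Definition ballot_cond (n a b c : nat) : bool :=
  (minn c n.+1 <= b) && (minn b n <= a).

Fixpoint ballot (n a b c : nat) (w : seq nat) : bool :=
  ballot_cond n a b c &&
  if w is l :: w' then ballot n (a + (l == 1)) (b + (l == 2)) (c + (l == 3)) w'
  else true.

Lemma ballotP n a b c w :
  ballot n a b c w <->
  forall i, ballot_cond n (a + count_mem 1 (take i w))
              (b + count_mem 2 (take i w)) (c + count_mem 3 (take i w)).
Proof.
elim: w a b c => [|l w IHw] a b c /=.
  rewrite andbT; split=> [h i|/(_ 0)]; by rewrite /= !addn0.
split=> [/andP[h0 /IHw h] [|i]|h]; first by rewrite take0 /= !addn0.
  by rewrite /= !addnA.
rewrite -[a]addn0 -[b]addn0 -[c]addn0 (h 0) !addn0; apply/IHw => i.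
by have := h i.+1; rewrite /= !addnA.
Qed.

Lemma ballot_cat n a b c x y :
  ballot n a b c (x ++ y) = ballot n a b c x &&
    ballot n (a + count_mem 1 x) (b + count_mem 2 x) (c + count_mem 3 x) y.
Proof.
elim: x a b c => [|l x IHx] a b c /=; last by rewrite IHx !addnA andbA.
by rewrite !addn0 andbT; case: y => [|l y] /=; rewrite ?andbT ?andbb // andbA andbb.
Qed.

(** Both truncation bounds rise by one together with the three counts. *)
Lemma ballot_shift n a b c w :
  ballot n.+1 a.+1 b.+1 c.+1 w = ballot n a b c w.
Proof.
have E a' b' c' : ballot_cond n.+1 a'.+1 b'.+1 c'.+1 = ballot_cond n a' b' c'.
  by rewrite /ballot_cond; lia.
by elim: w a b c => [|l w IHw] a b c /=; rewrite E // !addSn IHw.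
Qed.

Lemma ballot_shift_no3 n a b (w : seq nat) : 3 \notin w ->
  ballot n.+1 a.+1 b.+1 0 w = ballot n a b 0 w.
Proof.
have E a' b' : ballot_cond n.+1 a'.+1 b'.+1 0 = ballot_cond n a' b' 0.
  by rewrite /ballot_cond; lia.
elim: w a b => [|l w IHw] a b /=; rewrite E // inE negb_or => /andP[l3 w3].
have -> : (l == 3) = false by lia.
by rewrite addn0 !addSn IHw.
Qed.

Lemma ballot_lower n a b (w : seq nat) : 3 \notin w ->
  ballot n.+1 a b 0 w -> ballot n a b 0 w.
Proof.
have E a' b' : ballot_cond n.+1 a' b' 0 -> ballot_cond n a' b' 0.
  by rewrite /ballot_cond; lia.
elim: w a b => [|l w IHw] a b /=; first by rewrite !andbT => _ /E.
rewrite inE negb_or => /andP[l3 w3]; have -> : (l == 3) = false by lia.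
by rewrite addn0 => /andP[/E-> /IHw]; apply.
Qed.

(* The two conditions differ only when all n letters 1 and all n+1 letters 2
   have been read. *)
Lemma ballot_raise n a b (w : seq nat) : 3 \notin w -> a + b + size w <= n.*2 ->
  ballot n a b 0 w -> ballot n.+1 a b 0 w.
Proof.
have E a' b' : a' + b' <= n.*2 -> ballot_cond n a' b' 0 -> ballot_cond n.+1 a' b' 0.
  by rewrite /ballot_cond; lia.
elim: w a b => [|l w IHw] a b /=.
  by rewrite !andbT addn0 => _ h /(E _ _ h).
rewrite inE negb_or => /andP[l3 w3] sz; have -> : (l == 3) = false by lia.
rewrite addn0 => /andP[/E->]; last by lia.
by move/IHw; apply=> //; lia.
Qed.

Lemma ballot_cond0 n a b c w : ballot n a b c w -> ballot_cond n a b c.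
Proof. by case: w => [|? ?] /= /andP[]. Qed.

Lemma ballot_end n a b c w : ballot n a b c w ->
  ballot_cond n (a + count_mem 1 w) (b + count_mem 2 w) (c + count_mem 3 w).
Proof. by move/ballotP/(_ (size w)); rewrite take_size. Qed.

(** Prefixes ending in [x], [y], [z] lose respectively nothing, a 12, and one letter of each kind;
    [ballot_lower], [ballot_shift_no3] and [ballot_shift] treat the three cases. *)
Lemma ballot_del n (x y z : seq nat) : 3 \notin x ++ y ->
  ballot n.+1 0 0 0 (x ++ 1 :: 2 :: y ++ 3 :: z) ->
  ballot n 0 0 0 (x ++ y ++ z).
Proof.
rewrite mem_cat negb_or => /andP[x3 y3].
rewrite !ballot_cat /= ballot_cat /= !add0n.
have -> : count_mem 3 x = 0 by apply/count_memPn.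
have -> : count_mem 3 y = 0 by apply/count_memPn.
rewrite !addn0 !addn1 !addSn => /and5P[hx _ _ hy].
rewrite ballot_shift => /andP[_ ->]; rewrite (ballot_lower x3 hx) /= andbT.
by rewrite -ballot_shift_no3.
Qed.

(** The bound on [size x] serves [ballot_raise]: when [x] is [n] letters 1 followed by [n.+1]
    letters 2, the raised condition fails. *)
Lemma ballot_ins n (x y z : seq nat) : 3 \notin x ++ y -> size x <= n.*2 ->
  ballot n 0 0 0 (x ++ y ++ z) ->
  ballot n.+1 0 0 0 (x ++ 1 :: 2 :: y ++ 3 :: z).
Proof.
rewrite mem_cat negb_or => /andP[x3 y3] sx.
rewrite !ballot_cat /= ballot_cat /= !add0n.
have -> : count_mem 3 x = 0 by apply/count_memPn.
have -> : count_mem 3 y = 0 by apply/count_memPn.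
rewrite !addn0 !addn1 !addSn => /and3P[hx hy hz].
have hx' := @ballot_raise _ 0 0 x x3 sx hx.
rewrite ballot_shift hz ballot_shift_no3 // hy hx' !andbT /=.
have := ballot_end hx'; have := ballot_cond0 hy; have := ballot_end hy.
rewrite /ballot_cond !min0n !add0n /= => /andP[_ h1] /= h2 /andP[_ h3].
by rewrite h3 /=; lia.
Qed.

(** * Position lists and prefix counts *)

Lemma positions_cons x y w :
  positions x (y :: w) = nseq (y == x) 0 ++ map S (positions x w).
Proof.
rewrite /positions /= -(addn0 1) iotaDl filter_map.
by case: (y == x).
Qed.

Lemma size_positions (x : nat) (w : seq nat) : size (positions x w) = count_mem x w.
Proof.
by elim: w => // y w IHw; rewrite positions_cons size_cat size_nseq size_map IHw.
Qed.

Lemma nth_positions_lt (x : nat) (w : seq nat) j i : j < count_mem x w ->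
  (nth 0 (positions x w) j < i) = (j < count_mem x (take i w)).
Proof.
elim: w j i => // y w IHw j i; rewrite positions_cons.
case: i => [|i] /=; first by rewrite !ltn0.
case: (y == x) => /=; last first.
  rewrite !add0n => hj; rewrite (nth_map 0) ?size_positions // ltnS; exact: IHw.
case: j => [|j] //=; rewrite !add1n !ltnS => hj.
by rewrite (nth_map 0) ?size_positions //; exact: IHw.
Qed.

Lemma nth_positionsK (x : nat) (w : seq nat) j : j < count_mem x w ->
  nth 0 w (nth 0 (positions x w) j) = x.
Proof.
rewrite -size_positions => /(mem_nth 0).
by rewrite mem_filter => /andP[/eqP].
Qed.

(** By [nth_positions_lt], an occurrence lies before [i] exactly when enough letters are counted in
    the prefix of length [i]; comparing positions thus amounts to comparing counts in all prefixes,
    truncated at [m]. *)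
Lemma positions_lt_iff (x y : nat) (w : seq nat) m : x != y ->
  m <= count_mem x w -> m <= count_mem y w ->
  (forall j, j < m -> nth 0 (positions x w) j < nth 0 (positions y w) j) <->
  (forall i, minn (count_mem y (take i w)) m <= count_mem x (take i w)).
Proof.
move=> neq_xy mx my; split=> [lt_pos i|le_cnt j jm].
  case em: (minn _ _) => [//|j].
  have jm : j < m by lia.
  rewrite -nth_positions_lt; last by lia.
  by apply: ltn_trans (lt_pos j jm) _; rewrite nth_positions_lt; lia.
have jx : j < count_mem x w by lia.
have jy : j < count_mem y w by lia.
(* The prefix used ends exactly at the occurrence of [y] of index [j]. *)
have := le_cnt (nth 0 (positions y w) j).+1.
have := nth_positions_lt (nth 0 (positions y w) j).+1 jy.
rewrite ltnSn => /esym h1 h2.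
have : nth 0 (positions x w) j < (nth 0 (positions y w) j).+1.
  by rewrite nth_positions_lt //; lia.
rewrite ltnS leq_eqVlt => /orP[/eqP e|//].
by move: neq_xy; rewrite -(nth_positionsK jx) e nth_positionsK // eqxx.
Qed.

(** The parameter is one less than in [skew_yamanouchi], so that it equals the level in the tree. *)
Definition sky (n : nat) (w : seq nat) : Prop :=
  [/\ all (fun x => x \in [:: 1; 2; 3]) w, count_mem 1 w = n,
      count_mem 2 w = n.+1, count_mem 3 w = n.+2 & ballot n 0 0 0 w].

Lemma skyP n w : skew_yamanouchi n.+1 w <-> sky n w.
Proof.
rewrite /skew_yamanouchi /has_type /sky subn1 addn1 /=.
split.
  case/and3P=> /and4P[al /eqP c1 /eqP c2 /eqP c3] hn /forallP h.
  split=> //; apply/ballotP => i; apply/andP; rewrite !add0n; split.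
    apply: ((positions_lt_iff (m := n.+1) _ _ _).1 _ i) => //; rewrite ?c1 ?c2 ?c3 //.
    (* The last index [j = n] is the separate clause [hn] on the letters 2 and 3. *)
    move=> j; rewrite ltnS leq_eqVlt => /orP[/eqP->//|jn].
    by case/andP: (h (Ordinal jn)).
  apply: ((positions_lt_iff (m := n) _ _ _).1 _ i) => //; rewrite ?c1 ?c2 ?c3 //.
  by move=> j jn; case/andP: (h (Ordinal jn)).
case=> al c1 c2 c3 /ballotP h.
have h23 : forall j, j < n.+1 ->
    nth 0 (positions 2 w) j < nth 0 (positions 3 w) j.
  apply: (positions_lt_iff _ _ _).2 => //; rewrite ?c1 ?c2 ?c3 //.
  by move=> i; case/andP: (h i).
have h12 : forall j, j < n ->
    nth 0 (positions 1 w) j < nth 0 (positions 2 w) j.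
  apply: (positions_lt_iff _ _ _).2 => //; rewrite ?c1 ?c2 ?c3 //.
  by move=> i; case/andP: (h i).
rewrite al c1 c2 c3 !eqxx h23 //=; apply/forallP => j.
by rewrite h12 // h23 // ltnS ltnW.
Qed.

(** * Insertion and deletion of the letters 1, 2, 3 *)

Definition word_ins (t : seq nat) (u v : nat) : seq nat :=
  take v t ++ 1 :: 2 :: take (u - v) (drop v t) ++ 3 :: drop u t.

Definition word_del (s : seq nat) (u v : nat) : seq nat :=
  take v s ++ take (u - v) (drop v.+2 s) ++ drop (u + 3) s.

Lemma nth_word_ins t u v k : v <= u -> u <= size t ->
  nth 0 (word_ins t u v) k =
    if k < v then nth 0 t k else if k == v then 1 else if k == v.+1 then 2
    else if k < u + 2 then nth 0 t (k - 2) else if k == u + 2 then 3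
    else nth 0 t (k - 3).
Proof.
move=> le_vu le_us; rewrite /word_ins nth_cat size_take_min (minn_idPl _); last by lia.
case: ltnP => [kv|vk]; first by rewrite nth_take.
have [d ->] : exists d, k = v + d by exists (k - v); lia.
rewrite addKn; case: d => [|[|d]] /=.
- by rewrite addn0 eqxx.
- by rewrite addn1 eqxx; case: eqP => //; lia.
have -> : (v + d.+2 == v) = false by lia.
have -> : (v + d.+2 == v.+1) = false by lia.
rewrite nth_cat size_take_min size_drop (minn_idPl _); last by lia.
case: ltnP => h1.
  rewrite nth_take // nth_drop; have -> : v + d.+2 < u + 2 by lia.
  by congr nth; lia.
have -> : (v + d.+2 < u + 2) = false by lia.
have [e ->] : exists e, d = (u - v) + e by exists (d - (u - v)); lia.
rewrite addKn; case: e => [|e] /=.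
  by have -> : (v + (u - v + 0).+2 == u + 2) by lia.
have -> : (v + (u - v + e.+1).+2 == u + 2) = false by lia.
by rewrite nth_drop; congr nth; lia.
Qed.

Lemma size_word_ins t u v : v <= u -> u <= size t ->
  size (word_ins t u v) = (size t).+3.
Proof.
move=> le_vu le_us; rewrite /word_ins size_cat /= size_cat /= !size_take_min !size_drop; lia.
Qed.

Lemma nth_word_del s u v k : v <= u -> u + 3 <= size s ->
  nth 0 (word_del s u v) k =
    if k < v then nth 0 s k else if k < u then nth 0 s (k + 2)
    else nth 0 s (k + 3).
Proof.
move=> le_vu le_us; rewrite /word_del !nth_cat !size_take_min size_drop.
rewrite (minn_idPl _); last by lia.
rewrite (minn_idPl _); last by lia.
case: ltnP => [kv|vk]; first by rewrite nth_take.
case: ltnP => h.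
  rewrite nth_take // nth_drop; have -> : k < u by lia.
  by congr nth; lia.
have -> : (k < u) = false by lia.
by rewrite nth_drop; congr nth; lia.
Qed.

Lemma size_word_del s u v : v <= u -> u + 3 <= size s ->
  size (word_del s u v) = size s - 3.
Proof.
move=> le_vu le_us; rewrite /word_del !size_cat !size_take_min !size_drop; lia.
Qed.

Lemma word_insK t u v : v <= u -> u <= size t ->
  word_del (word_ins t u v) u v = t.
Proof.
move=> le_vu le_us; have sz := size_word_ins le_vu le_us.
have le_us' : u + 3 <= size (word_ins t u v) by lia.
apply: (@eq_from_nth _ 0) => [|i _]; first by rewrite size_word_del // sz; lia.
rewrite nth_word_del // !nth_word_ins //.
case: ltnP => // vi; case: ltnP => iu.
  have -> : (i + 2 < v) = false by lia.
  have -> : (i + 2 == v) = false by lia.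
  have -> : (i + 2 == v.+1) = false by lia.
  by rewrite ltn_add2r iu addnK.
have -> : (i + 3 < v) = false by lia.
have -> : (i + 3 == v) = false by lia.
have -> : (i + 3 == v.+1) = false by lia.
have -> : (i + 3 < u + 2) = false by lia.
have -> : (i + 3 == u + 2) = false by lia.
by rewrite addnK.
Qed.

Lemma word_delK s u v : v <= u -> u + 3 <= size s ->
  nth 0 s v = 1 -> nth 0 s v.+1 = 2 -> nth 0 s (u + 2) = 3 ->
  word_ins (word_del s u v) u v = s.
Proof.
move=> le_vu le_us s1 s2 s3; have sz := size_word_del le_vu le_us.
have le_us' : u <= size (word_del s u v) by lia.
apply: (@eq_from_nth _ 0) => [|i _]; first by rewrite size_word_ins // sz; lia.
rewrite nth_word_ins // !nth_word_del //.
case: ltnP => // vi; case: eqP => [->//|iv]; case: eqP => [->//|iv'].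
case: ltnP => iu.
  have -> : (i - 2 < v) = false by lia.
  have -> : i - 2 < u by lia.
  by congr nth; lia.
case: eqP => [->//|iu'].
have -> : (i - 3 < v) = false by lia.
have -> : (i - 3 < u) = false by lia.
by congr nth; lia.
Qed.

Lemma size_letters w : all (fun x => x \in [:: 1; 2; 3]) w ->
  size w = count_mem 1 w + count_mem 2 w + count_mem 3 w.
Proof.
elim: w => //= l w IHw /andP[+ /IHw->]; rewrite !inE.
by case/or3P=> /eqP-> /=; lia.
Qed.

Lemma index3_take (t : seq nat) u : u <= index 3 t -> 3 \notin take u t.
Proof.
by move=> le_u; apply/negP => /index_ltn; lia.
Qed.

Lemma nth_eq3 (t : seq nat) u : 3 \in t -> u <= index 3 t ->
  (nth 0 t u == 3) = (u == index 3 t).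
Proof.
move=> t3; rewrite leq_eqVlt => /orP[/eqP->|lt_u].
  by rewrite nth_index // !eqxx.
by have /= -> := before_find 0 lt_u; rewrite (ltn_eqF lt_u).
Qed.

Lemma take_split (t : seq nat) u v : v <= u ->
  take u t = take v t ++ take (u - v) (drop v t).
Proof. by move=> le_vu; rewrite -takeD subnKC. Qed.

Lemma word_split (t : seq nat) u v : v <= u ->
  t = take v t ++ take (u - v) (drop v t) ++ drop u t.
Proof. by move=> le_vu; rewrite catA -take_split // cat_take_drop. Qed.

Lemma count_word_ins (a : pred nat) t u v : v <= u ->
  count a (word_ins t u v) = a 1 + a 2 + a 3 + count a t.
Proof.
move=> le_vu; rewrite {2}(word_split t le_vu) /word_ins !count_cat /=.
by rewrite !count_cat /=; lia.
Qed.

Lemma sky_mem3 n t : sky n t -> 3 \in t.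
Proof. by case=> _ _ _ c3 _; rewrite -has_pred1 has_count c3. Qed.

(** Only letters 1 and 2 precede the first 3. With [v < alpha t] this gives [v <= n.*2], the length
    bound of [ballot_ins]. *)
Lemma sky_index3 n t : sky n t -> index 3 t <= n.*2.+1.
Proof.
case=> al c1 c2 c3 _.
have al' : all (fun x => x \in [:: 1; 2; 3]) (take (index 3 t) t).
  by apply/allP => x /mem_take xt; apply: (allP al).
have /count_memPn c3' := index3_take (leqnn (index 3 t)).
have := size_letters al'; rewrite c3' size_take_min (minn_idPl (index_size _ _)).
move: c1 c2; rewrite -{1 2}(cat_take_drop (index 3 t) t) !count_cat; lia.
Qed.

Lemma sky_ins n t u v : sky n t -> admissible (alpha t) (setB t) u v ->
  sky n.+1 (word_ins t u v).
Proof.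
move=> skt [le_vu le_up lt_vp _].
have no3 := index3_take le_up; rewrite (take_split _ le_vu) in no3.
have ltp := sky_index3 skt.
case: skt => al c1 c2 c3 bal.
have ET := word_split t le_vu; rewrite {1}ET in al; rewrite {1}ET in bal.
split.
- by move: al; rewrite /word_ins !all_cat /= all_cat /=.
- by rewrite count_word_ins // c1.
- by rewrite count_word_ins // c2.
- by rewrite count_word_ins // c3.
- apply: ballot_ins => //; rewrite size_take_min.
  by move: lt_vp; rewrite /alpha; lia.
Qed.

Lemma alpha_ins n t u v : sky n t -> admissible (alpha t) (setB t) u v ->
  alpha (word_ins t u v) = u + 2.
Proof.
move=> skt [le_vu le_up lt_vp _].
have us : u <= size t by apply: leq_trans le_up (index_size _ _).
have := index3_take le_up; rewrite (take_split _ le_vu) mem_cat negb_or.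
case/andP=> /negPf x3 /negPf y3.
rewrite /alpha /word_ins index_cat x3 /= index_cat y3 /= !size_take_min size_drop.
by lia.
Qed.

(** A factor 12 left of the insertion stays in place, the inserted one is recorded as [v.+1], and
    one further right with [k <= u] would come from [k - 2] in [setB t], strictly between [v] and
    [u]. *)
Lemma setB_ins n t u v : sky n t -> admissible (alpha t) (setB t) u v ->
  forall k, setB (word_ins t u v) k = child_set (setB t) u v k.
Proof.
move=> skt adm k; have ea := alpha_ins skt adm.
case: adm => le_vu le_up lt_vp noB.
have us : u <= size t by apply: leq_trans le_up (index_size _ _).
rewrite /child_set; case: (posnP k) => [->//|k0].
rewrite /setB /= ea leq_add2r !nth_word_ins //.
have -> : (k == 0) = false by lia.
rewrite k0 /=; case: (ltngtP k v) => [kv|vk|ekv] /=.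
- have -> : k.-1 < v by lia.
  have -> : (k == v.+1) = false by lia.
  have -> : k + 2 <= alpha t by lia.
  have -> : k <= u by lia.
  by rewrite andbF orbF.
- have -> : (k.-1 < v) = false by lia.
  have [ekv|nkv] := eqVneq k v.+1.
    by rewrite ekv /= eqxx andbT.
  rewrite andbF; have -> : (k.-1 == v) = false by lia.
  have [//|nkv'] := eqVneq k.-1 v.+1; apply/negP => /and3P[].
  case: (leqP k u) => // ku.
  have -> : k.-1 < u + 2 by lia.
  have -> : k < u + 2 by lia.
  move=> h1 h2 _; have /noB : v < k - 2 < u by lia.
  rewrite /setB /= h2 negb_or.
  have -> : (k - 2).-1 = k.-1 - 2 by lia.
  by rewrite h1 /=; lia.
- by rewrite ekv andbF; case: (v == v.+1) (ltn_eqF (ltnSn v)) => //; rewrite andbF.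
Qed.

(** The initial run determines [u]. If [v < v'], the 12 inserted into [t'] at [v'] would be read in
    [t] as a factor forbidden by the admissibility of [(u, v)]. *)
Lemma word_ins_inj n t u v t' u' v' :
  sky n t -> admissible (alpha t) (setB t) u v ->
  sky n t' -> admissible (alpha t') (setB t') u' v' ->
  word_ins t u v = word_ins t' u' v' -> [/\ t = t', u = u' & v = v'].
Proof.
have main : forall t u v t' v',
    sky n t -> admissible (alpha t) (setB t) u v ->
    sky n t' -> admissible (alpha t') (setB t') u v' ->
    word_ins t u v = word_ins t' u v' -> ~~ (v < v').
  move=> {}t {}u {}v {}t' {}v' sk [le_vu le_up lt_vp noB].
  move=> sk' [le_vu' le_up' lt_vp' _] e; apply/negP => vv'.
  have us : u <= size t by apply: leq_trans le_up (index_size _ _).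
  have us' : u <= size t' by apply: leq_trans le_up' (index_size _ _).
  have E k := congr1 (fun s => nth 0 s k) e.
  have := E v'; have := E v'.+1; have := E (u + 3).
  rewrite /= !nth_word_ins //.
  have -> : (u + 3 < v) = false by lia.
  have -> : (u + 3 == v) = false by lia.
  have -> : (u + 3 == v.+1) = false by lia.
  have -> : (u + 3 < v') = false by lia.
  have -> : (u + 3 == v') = false by lia.
  have -> : (u + 3 == v'.+1) = false by lia.
  have -> : (u + 3 < u + 2) = false by lia.
  have -> : (u + 3 == u + 2) = false by lia.
  rewrite addnK => e3.
  (* Whether [u] reaches the label of the parent is visible in the child: the letter after its first
     3 is then a 3. *)
  have e3' : (u == alpha t) = (u == alpha t').
    by rewrite -!nth_eq3 ?e3 //; [apply: sky_mem3 sk' | apply: sky_mem3 sk].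
  rewrite !ltnn !eqxx.
  have -> : (v'.+1 < v) = false by lia.
  have -> : (v' < v) = false by lia.
  have -> : (v'.+1 < v') = false by lia.
  have -> : (v'.+1 == v') = false by lia.
  have -> : (v'.+1 == v) = false by lia.
  have -> : (v' == v) = false by lia.
  have -> : (v'.+1 == v.+1) = false by lia.
  have -> : v'.+1 < u + 2 by lia.
  have -> : v' < u + 2 by lia.
  case: eqP => // nv h2 h1.
  (* The bound [v'.+1 <= alpha t] in [setB] can fail only if [v' = u = alpha t]; then [u = alpha t']
     by [e3'], against [v' < alpha t']. *)
  have /noB : v < v'.-1 < u by lia.
  rewrite /setB /= (_ : v'.-1 = v'.+1 - 2) ?h2; last by lia.
  rewrite (_ : (v'.+1 - 2).-1 = v' - 2) ?h1; last by lia.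
  by lia.
move=> sk adm sk' adm' e.
have eu : u = u'.
  by have := alpha_ins sk adm; rewrite e (alpha_ins sk' adm'); lia.
subst u'.
have ev : v = v'.
  have := main _ _ _ _ _ sk adm sk' adm' e.
  by have := main _ _ _ _ _ sk' adm' sk adm (esym e); lia.
subst v'; split=> //.
case: adm adm' => le_vu le_up _ _ [_ le_up' _ _].
rewrite -(@word_insK t u v) // ?e ?word_insK //.
  by apply: leq_trans le_up' (index_size _ _).
by apply: leq_trans le_up (index_size _ _).
Qed.

Lemma nth_before_index (x : nat) s i : i < index x s -> (nth 0 s i == x) = false.
Proof. exact: (before_find 0). Qed.

(* If the initial run is followed by 33, then it contains two letters 2. *)
Lemma sky_factor12 n s : sky n.+1 s ->
  exists v, [&& nth 0 s v == 1, nth 0 s v.+1 == 2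
              & v.+2 + (nth 0 s (index 3 s).+1 == 3) <= index 3 s].
Proof.
move=> sk; have s3 := sky_mem3 sk; case: sk => al c1 c2 c3 /ballotP bal.
have s2 : 2 \in s by rewrite -has_pred1 has_count c2.
have cnt_gt0 x i : (0 < count_mem x (take i s)) = (x \in take i s).
  by rewrite -has_count has_pred1.
set p := index 3 s; set j := index 2 s.
have sj : nth 0 s j = 2 by apply: nth_index.
have sp : nth 0 s p = 3 by apply: nth_index.
(* The prefix ending at the first 3 must contain a 2; likewise, below, the prefix ending at the
   first 2 must contain a 1. *)
have jp : j < p.
  have : 3 \in take p.+1 s by rewrite in_take // ltnS.
  rewrite -cnt_gt0 => h3; have /andP[h _] := bal p.+1.
  have /index_ltn : 2 \in take p.+1 s by rewrite -cnt_gt0; lia.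
  rewrite -/j ltnS leq_eqVlt => /orP[/eqP e|//].
  by move: sp; rewrite -e sj.
have j0 : 0 < j.
  have : 2 \in take j.+1 s by rewrite in_take // ltnS.
  rewrite -cnt_gt0 => h2; have /andP[_ h] := bal j.+1.
  have /index_ltn : 1 \in take j.+1 s by rewrite -cnt_gt0; lia.
  rewrite ltnS => i1; rewrite lt0n; apply/eqP => e0.
  have e1 : index 1 s = 0 by lia.
  have : nth 0 s (index 1 s) = 1.
    by apply: nth_index; rewrite -has_pred1 has_count c1.
  by move: sj; rewrite e0 e1 => ->.
have js : j < size s by rewrite index_mem.
have ps : p < size s by rewrite index_mem.
(* The letter just before the first 2 also precedes the first 3, so only 1 is left. *)
have s1 : nth 0 s j.-1 = 1.
  have : nth 0 s j.-1 \in [:: 1; 2; 3].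
    by apply/(allP al)/mem_nth/(leq_ltn_trans (leq_pred _) js).
  have n2 : (nth 0 s j.-1 == 2) = false by apply: nth_before_index; rewrite -/j; lia.
  have n3 : (nth 0 s j.-1 == 3) = false by apply: nth_before_index; rewrite -/p; lia.
  by rewrite !inE n2 n3 !orbF => /eqP.
exists j.-1; rewrite s1 prednK // sj !eqxx /= -/p.
case: eqP => [e3|_]; last by lia.
have ps2 : p.+1 < size s.
  by rewrite ltnNge; apply/negP => /(nth_default 0); rewrite e3.
rewrite leqNgt; apply/negP => lt_p.
have ep : p = j.+1 by lia.
(* The prefix ending with 33 would contain two letters 3 but a single 2. *)
have /andP[h _] := bal p.+2; move: h.
rewrite (take_nth 0) // e3 (take_nth 0) // sp ep (take_nth 0) // sj.
rewrite -!cats1 !count_cat /=.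
have -> : count_mem 2 (take j s) = 0.
  by apply/count_memPn/negP => /index_ltn; rewrite ltnn.
by lia.
Qed.

Lemma sky_surj n s : sky n.+1 s ->
  exists t u v, [/\ sky n t, admissible (alpha t) (setB t) u v
                  & s = word_ins t u v].
Proof.
move=> sk; have s3 := sky_mem3 sk.
have ps : index 3 s < size s by rewrite index_mem.
have bnd v : [&& nth 0 s v == 1, nth 0 s v.+1 == 2
      & v.+2 + (nth 0 s (index 3 s).+1 == 3) <= index 3 s] -> v <= index 3 s.
  by case/and3P=> _ _; lia.
(* The rightmost allowed factor 12 is deleted; its maximality gives the last clause of
   [admissible]. *)
case: (ex_maxnP (sky_factor12 sk) bnd) => v /and3P[/eqP sv /eqP sv' hv] vmax.
have [u up] : exists u, index 3 s = u + 2 by exists (index 3 s - 2); lia.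
have sp : nth 0 s (u + 2) = 3 by rewrite -up nth_index.
rewrite up in hv vmax ps.
have le_vu : v <= u by lia.
have us : u + 3 <= size s by lia.
have es := word_delK le_vu us sv sv' sp.
set t := word_del s u v in es.
have st : size t = size s - 3 by apply: size_word_del.
have us' : u <= size t by lia.
have le_up : u <= index 3 t.
  rewrite leqNgt; apply/negP => lt_u.
  have t3 : 3 \in t by rewrite -index_mem; apply: leq_trans lt_u us'.
  have := nth_index 0 t3; rewrite nth_word_del // lt_u.
  by case: ifP => _ /eqP; rewrite nth_before_index // up; lia.
(* The run of [s] is followed by 33 exactly when [u = alpha t]; the extra unit in [hv] then forces
   [v < u], whence [v < alpha t] in all cases. *)
have eu : (nth 0 s (u + 2).+1 == 3) = (nth 0 t u == 3).
  rewrite nth_word_del // ltnn; have -> : (u < v) = false by lia.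
  by rewrite -addnS.
have skt : sky n t.
  case: sk; rewrite -{1 2 3 4 5}es => al c1 c2 c3 bal.
  rewrite !count_word_ins // in c1 c2 c3.
  split.
  - rewrite (word_split t le_vu); move: al.
    by rewrite /word_ins !all_cat /= all_cat /=.
  - by case: c1.
  - by case: c2.
  - by case: c3.
  - rewrite (word_split t le_vu); apply: ballot_del bal.
    by rewrite -take_split //; apply: index3_take.
have t3 := sky_mem3 skt.
exists t, u, v; split=> //; split=> //.
  move: hv; rewrite eu nth_eq3 // /alpha; lia.
move=> k /andP[vk ku]; apply/negP.
rewrite /setB /= => /orP[/eqP|/and4P[k0 /eqP k1 /eqP k2 kp]]; first by lia.
(* Such a [k] would give a factor 12 of [s] at position [k.+1], beyond [v]. If [u = alpha t], the
   bound [kp] keeps it off the last letter of the run. *)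
move: hv (vmax k.+1); rewrite eu nth_eq3 //.
have <- : nth 0 t k.-1 = nth 0 s k.+1.
  rewrite nth_word_del //; have -> : (k.-1 < v) = false by lia.
  have -> : k.-1 < u by lia.
  by congr nth; lia.
have <- : nth 0 t k = nth 0 s k.+2.
  rewrite nth_word_del //; have -> : (k < v) = false by lia.
  by rewrite ku; congr nth; lia.
by rewrite k1 k2 /=; move: kp; rewrite /alpha; lia.
Qed.

Lemma sky_root w : sky 0 w <-> w = [:: 2; 3; 3].
Proof.
split=> [[al c1 c2 c3 bal]|->] //.
have := size_letters al; rewrite c1 c2 c3.
case: w al c1 c2 c3 bal => [|a [|b [|c [|]]]] //= /and4P[].
by rewrite !inE => /or3P[] /eqP-> /or3P[] /eqP-> /or3P[] /eqP->.
Qed.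

Lemma setB_root k : setB [:: 2; 3; 3] k = (k == 0).
Proof.
rewrite /setB /=; have -> : (k + 2 <= 1) = false by lia.
by rewrite !andbF orbF.
Qed.

Definition word_tree : succession_tree :=
  @SuccessionTree (seq nat) sky alpha (fun w => setB w) [:: 2; 3; 3] word_ins
    sky_root erefl setB_root sky_ins sky_surj word_ins_inj alpha_ins setB_ins.

(** * One-line notation *)

Lemma one_lineE m (pi : 'S_m) : one_line pi = [seq (pi i).+1 | i <- enum 'I_m].
Proof. by []. Qed.

Lemma size_one_line m (pi : 'S_m) : size (one_line pi) = m.
Proof. by rewrite one_lineE size_map size_enum_ord. Qed.

Lemma nth_one_line m (pi : 'S_m) (i : 'I_m) : nth 0 (one_line pi) i = (pi i).+1.
Proof. by rewrite one_lineE (nth_map i) ?size_enum_ord // nth_ord_enum. Qed.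

Lemma one_line_uniq m (pi : 'S_m) : uniq (one_line pi).
Proof.
rewrite one_lineE map_inj_uniq ?enum_uniq // => i j [] /val_inj.
exact: perm_inj.
Qed.

Lemma index_one_line m (pi : 'S_m) (i : 'I_m) : index (pi i).+1 (one_line pi) = i.
Proof.
by rewrite -nth_one_line index_uniq ?size_one_line ?one_line_uniq.
Qed.

Lemma one_lineP m (pi : 'S_m) x :
  reflect (exists i, x = (pi i).+1) (x \in one_line pi).
Proof.
rewrite one_lineE; apply: (iffP mapP) => [[i _ ->]|[i ->]]; first by exists i.
by exists i; rewrite ?mem_enum.
Qed.

Lemma one_line_inj m : injective (@one_line m).
Proof.
move=> p q e; apply/permP => i; apply: val_inj.
by have := congr1 (fun s => nth 0 s i) e; rewrite !nth_one_line => -[].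
Qed.

Lemma one_line_du4123 m (pi : 'S_m) : pi \in DU4123 m <-> du4123 m (one_line pi).
Proof.
rewrite inE; split.
  case/andP=> /forallP du av; split.
  - exact: one_line_uniq.
  - exact: size_one_line.
  - by move=> x /one_lineP[i ->]; rewrite ltn_ord.
  - move=> i; rewrite size_one_line => hi.
    have /forallP/(_ (Ordinal hi))/implyP/(_ (eqxx _)) := du (Ordinal (ltnW hi)).
    have := nth_one_line pi (Ordinal hi); have := nth_one_line pi (Ordinal (ltnW hi)).
    by move=> /= -> ->; rewrite !ltnS.
  - move=> a b c d iab ibc icd dI bc cd; apply/negP => da.
    have mem x y : index x (one_line pi) < index y (one_line pi) ->
        y \in one_line pi -> x \in one_line pi.
      by rewrite -!index_mem; lia.
    have cI := mem _ _ icd dI; have bI := mem _ _ ibc cI.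
    have /one_lineP[i1 e1] := mem _ _ iab bI; subst a.
    have /one_lineP[i4 e4] := dI; have /one_lineP[i3 e3] := cI.
    have /one_lineP[i2 e2] := bI; subst b c d.
    rewrite !index_one_line in iab ibc icd.
    case/negP: av; do 4 (apply/existsP; eexists).
    by apply/and5P; split; [exact: iab | exact: ibc | exact: icd | by [] |apply/andP].
case=> _ _ _ alt av; apply/andP; split.
  apply/forallP => i; apply/forallP => j; apply/implyP => /eqP ej.
  have := alt i; rewrite size_one_line -ej ltn_ord !nth_one_line => /(_ isT).
  by rewrite !ltnS.
apply/negP.
case/existsP=> i1 /existsP[i2 /existsP[i3 /existsP[i4 /and5P[h1 h2 h3 h4]]]].
case/andP=> h5 h6.
have := av (pi i1).+1 (pi i2).+1 (pi i3).+1 (pi i4).+1.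
have mem4 : (pi i4).+1 \in one_line pi by apply/one_lineP; exists i4.
by rewrite !index_one_line !ltnS h6 => /(_ h1 h2 h3 mem4 h4 h5).
Qed.

Lemma one_line_surj m s : du4123 m s -> exists pi : 'S_m, one_line pi = s.
Proof.
case=> Us sz rg _ _.
have rg_nth i : i < m -> 0 < nth 0 s i <= m.
  by move=> hi; apply: rg; rewrite mem_nth ?sz.
have bnd (i : 'I_m) : (nth 0 s i).-1 < m by move: (rg_nth i (ltn_ord i)); lia.
have inj : injective (fun i : 'I_m => Ordinal (bnd i)).
  move=> i j [] e; apply/val_inj/eqP; rewrite /= -(nth_uniq 0 _ _ Us) ?sz //.
  have [/andP[i0 _] /andP[j0 _]] := (rg_nth i (ltn_ord i), rg_nth j (ltn_ord j)).
  by rewrite -(prednK i0) e prednK.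
exists (perm inj); apply: (@eq_from_nth _ 0); rewrite size_one_line // => i hi.
rewrite (nth_one_line _ (Ordinal hi)) permE /=.
by move: (rg_nth i hi); lia.
Qed.

Lemma setA_one_line m (pi : 'S_m) k : setA pi k = ascents (one_line pi) k.
Proof.
rewrite /setA /ascents /=; congr (_ || _); apply/existsP/and3P.
  case=> i /existsP[j /and4P[ij /eqP<- /eqP e hk]]; split=> //.
    by rewrite -e; apply/one_lineP; exists j.
  by rewrite -e !index_one_line.
case=> kI ik hk.
have /one_lineP[i ei] : k \in one_line pi by move: kI; rewrite -!index_mem; lia.
have /one_lineP[j ej] := kI; exists i; apply/existsP; exists j.
by rewrite -ei -ej !eqxx hk !andbT; move: ik; rewrite {1}ei ej !index_one_line.
Qed.

(** * The bijection given by matching the two trees *)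

Theorem theorem2p7 (n : nat) (hn : 1 <= n) :
  exists psi : {p : 'S_(2 * n - 1) | p \in DU4123 (2 * n - 1)} ->
               {w : seq nat | skew_yamanouchi n w},
    bijective psi /\
    forall p : {p : 'S_(2 * n - 1) | p \in DU4123 (2 * n - 1)},
      first_entry (val p) = alpha (val (psi p)) /\
      setA (val p) =i setB (val (psi p)).
Proof.
case: n hn => // n _.
have em : 2 * n.+1 - 1 = n.*2.+1 by lia.
(* The size is made a variable so that the dependent type of permutations need not be rewritten. *)
move: (2 * n.+1 - 1) em => m em.
pose M (p : {p : 'S_m | p \in DU4123 m}) (w : {w : seq nat | skew_yamanouchi n.+1 w}) :=
  @matched perm_tree word_tree n (one_line (val p)) (val w).
have tot p : exists w, M p w.
  have : @level perm_tree n (one_line (val p)).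
    by rewrite /= -em; apply/one_line_du4123; apply: valP.
  case/(matched_total word_tree) => w mw.
  have [_ /skyP sw _ _] := matched_sound mw.
  by exists (Sub w sw).
(* A choice of images exists constructively because the permutations form a finite type. *)
have [psi psiP] := fin_all_exists tot.
have psi_inj : injective psi.
  move=> p q e; apply: val_inj; apply: one_line_inj.
  apply: matched_fun (matched_sym (psiP p)) _.
  by rewrite e; apply: matched_sym (psiP q).
(* Stated with boolean equality so that [xchoose] can extract a preimage and define the inverse. *)
have psi_surj w : exists p, psi p == w.
  have : @level word_tree n (val w) by apply/skyP; apply: valP.
  case/(matched_total perm_tree) => s mw.
  have [_ ls _ _] := matched_sound mw; rewrite /= -em in ls.
  have [p ep] := one_line_surj ls; rewrite -ep in ls mw.
  have pD : p \in DU4123 m by apply/one_line_du4123.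
  exists (Sub p pD); apply/eqP/val_inj; apply: matched_fun (psiP _) _.
  exact: matched_sym mw.
exists psi; split.
  exists (fun w => xchoose (psi_surj w)) => [p|w].
    by apply: psi_inj; apply/eqP; apply: xchooseP (psi_surj (psi p)).
  by apply/eqP; apply: xchooseP (psi_surj w).
move=> p; have [_ _ ep eA] := matched_sound (psiP p).
by split=> // k; rewrite -!topredE /= setA_one_line; apply: eA.
Qed.
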